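(* Let $(M,\langle\cdot,\cdot\rangle_g)$ be a semi-Riemannian manifold without boundary of dimension $n\ge 3$. Let $f\colon M\to\mathbb{R}$ be a transnormal function with $\langle\nabla_g f,\nabla_g f\rangle_g=a\circ f$, let $w\colon\mathbb{R}\to\mathbb{R}$ be smooth, and suppose $F\colon M\times\mathbb{R}^2\to\mathbb{R}$ is $f$-invariant in the first variable, with associated function $\widehat F\colon \mathrm{Im}\,f\times\mathbb{R}^2\to\mathbb{R}$. Then $u=w\circ f$ is a solution to the equation $$F(x,u(x),\langle\nabla_g u(x),\nabla_g u(x)\rangle_g)=0\qquad\text{for all }x\in M$$ if and only if $w$ is a solution to $$\widehat F\left(t,w(t),a(t)|w'(t)|^2\right)=0\qquad\text{for all }t\in\mathrm{Im}\,f\subset\mathbb{R}.$$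
   Context: A smooth function $f\colon M\to\mathbb{R}$ on a semi-Riemannian manifold $(M,g)$ is called transnormal if there is a smooth function $a\colon\mathbb{R}\to\mathbb{R}$ such that $\langle\nabla_g f,\nabla_g f\rangle_g=a\circ f$, where $\nabla_g$ denotes the gradient with respect to $g$. A function $F\colon M\times\mathbb{R}^2\to\mathbb{R}$ is $f$-invariant in the first variable if $F(x_1,r,p)=F(x_2,r,p)$ for all $(r,p)\in\mathbb{R}^2$ whenever $x_1,x_2\in M$ satisfy $f(x_1)=f(x_2)$. In that case $\widehat F\colon\mathrm{Im}\,f\times\mathbb{R}^2\to\mathbb{R}$ denotes the unique function with $F(x,r,p)=\widehat F(f(x),r,p)$ for all $x\in M$, $(r,p)\in\mathbb{R}^2$. *)

(* Defs.v *)
From HB Require Import structures.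
From mathcomp Require Import all_boot all_order all_algebra.
From mathcomp Require Import all_classical all_reals all_analysis.

Set Implicit Arguments.
Unset Strict Implicit.
Unset Printing Implicit Defensive.

Import Order.TTheory GRing.Theory Num.Theory.
Import numFieldNormedType.Exports.

Local Open Scope classical_set_scope.
Local Open Scope ring_scope.

(* On an open subset U of a finite-dimensional V this is the usual notion of
   class C^k: the map x |-> 'd f x is C^k iff x |-> 'D_v f x is, for all v. *)
Fixpoint Ck_on (R : realType) (V W : normedModType R) (k : nat)
    (U : set V) (f : V -> W) : Prop :=
  match k with
  | 0 => forall x, U x -> {for x, continuous f}
  | k'.+1 => (forall x, U x -> differentiable f x) /\
             (forall v, Ck_on k' U ('D_v f))
  end.

Definition smooth_on (R : realType) (V W : normedModType R)
    (U : set V) (f : V -> W) : Prop := forall k, Ck_on k U f.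

(* A homeomorphism from an open subset of M onto an open subset of R^n. The
   functions chart_map and chart_inv are total; their values outside of
   chart_dom and chart_cod are irrelevant. *)
Record chart (R : realType) (n : nat) (M : topologicalType) := Chart {
  chart_dom : set M ;
  chart_cod : set 'rV[R]_n ;
  chart_map :> M -> 'rV[R]_n ;
  chart_inv : 'rV[R]_n -> M ;
  chart_dom_open : open chart_dom ;
  chart_cod_open : open chart_cod ;
  chart_map_cod : forall p, chart_dom p -> chart_cod (chart_map p) ;
  chart_inv_dom : forall x, chart_cod x -> chart_dom (chart_inv x) ;
  chart_mapK : forall p, chart_dom p -> chart_inv (chart_map p) = p ;
  chart_invK : forall x, chart_cod x -> chart_map (chart_inv x) = x ;
  chart_map_cont : forall p, chart_dom p -> {for p, continuous chart_map} ;
  chart_inv_cont : forall x, chart_cod x -> {for x, continuous chart_inv} }.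

(* The atlas is not required to be maximal. The function chart_at selects,
   for each point, a chart of the atlas around it; it expresses that the atlas
   covers M, and serves to represent the tangent spaces below. *)
Record smoothManifold (R : realType) (n : nat) := SmoothManifold {
  manifold_carrier :> topologicalType ;
  manifold_hausdorff : hausdorff_space manifold_carrier ;
  manifold_second_countable : @second_countable manifold_carrier ;
  atlas : set (chart R n manifold_carrier) ;
  chart_at : manifold_carrier -> chart R n manifold_carrier ;
  chart_at_atlas : forall p, atlas (chart_at p) ;
  chart_at_dom : forall p, chart_dom (chart_at p) p ;
  atlas_compatible : forall c d, atlas c -> atlas d ->
    smooth_on (chart_cod c `&` chart_inv c @^-1` chart_dom d)
              (d \o chart_inv c) }.

Definition smooth_fun (R : realType) (n : nat) (M : smoothManifold R n)
    (f : M -> R) : Prop :=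
  forall c, atlas c -> smooth_on (chart_cod c) (f \o chart_inv c).

(* A tangent vector at p is represented by its components in the preferred
   chart at p; the components of the same vector in another chart are related
   to these by the differential of the transition map. *)
Definition tangent (R : realType) (n : nat) (M : smoothManifold R n) (p : M) :
  vectType R := 'rV[R]_n.

Definition coord_vector (R : realType) (n : nat) (M : smoothManifold R n)
    (c : chart R n M) (i : 'I_n) (p : M) : tangent p :=
  'd (chart_at p \o chart_inv c) (c p) (delta_mx 0 i).

Definition differential (R : realType) (n : nat) (M : smoothManifold R n)
    (f : M -> R) (p : M) (X : tangent p) : R :=
  'd (f \o chart_inv (chart_at p)) (chart_at p p) X.

Definition negative_definite (R : realType) (V : vectType R)
    (b : {symmetric V}) (W : {vspace V}) : Prop :=
  forall v, v \in W -> v != 0 -> b v v < 0.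

Definition has_index (R : realType) (V : vectType R)
    (b : {symmetric V}) (nu : nat) : Prop :=
  (exists2 W : {vspace V}, negative_definite b W & \dim W = nu) /\
  (forall W : {vspace V}, negative_definite b W -> (\dim W <= nu)%N).

Record semiRiemannianMetric (R : realType) (n : nat)
    (M : smoothManifold R n) := SemiRiemannianMetric {
  metric :> forall p : M, {symmetric (tangent p)} ;
  metric_nondegenerate : forall p, nondegenerate (metric p) ;
  metric_constant_index : exists nu : nat, forall p, has_index (metric p) nu ;
  metric_smooth : forall c, atlas c -> forall i j : 'I_n,
    smooth_on (chart_cod c) (fun x =>
      let p := chart_inv c x in
      metric p (coord_vector c i p) (coord_vector c j p)) }.

(* The vector metrically equivalent to the differential of f; it exists and is
   unique because the metric is nondegenerate. *)
Definition gradient (R : realType) (n : nat) (M : smoothManifold R n)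
    (g : semiRiemannianMetric M) (f : M -> R) (p : M) : tangent p :=
  xget 0 [set v : tangent p | forall X : tangent p,
                                g p v X = differential f X].

Definition transnormal_with (R : realType) (n : nat) (M : smoothManifold R n)
    (g : semiRiemannianMetric M) (f : M -> R) (a : R -> R) : Prop :=
  [/\ smooth_fun f, smooth_on setT a &
      forall x, g x (gradient g f x) (gradient g f x) = a (f x)].

Definition invariant_fst (R : realType) (n : nat) (M : smoothManifold R n)
    (f : M -> R) (F : M -> R -> R -> R) : Prop :=
  forall x1 x2, f x1 = f x2 -> forall r p, F x1 r p = F x2 r p.

Definition to_image (T U : Type) (f : T -> U) (x : T) : range f :=
  exist _ (f x) (mem_set (imageT f x)).

(* Main.v *)
Require Import Defs.
From HB Require Import structures.
From mathcomp Require Import all_boot all_order all_algebra.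
From mathcomp Require Import all_classical all_reals all_analysis.

Import Order.TTheory GRing.Theory Num.Theory.
Import numFieldNormedType.Exports.

Local Open Scope classical_set_scope.
Local Open Scope ring_scope.

(** The squared length of the gradient of w o f is determined pointwise by that
    of f.  By the chain rule d(w o f) = (w' o f) df, and since the metric is
    nondegenerate a tangent vector is determined by its products with all
    tangent vectors, so grad (w o f) = (w' o f) grad f ([gradient_comp]).
    Bilinearity of the metric and transnormality of f then give

      <grad (w o f), grad (w o f)> = (w' o f)^2 <grad f, grad f>
                                   = (a o f) |w' o f|^2,

    so at a point x the partial differential equation is literally the ordinary
    one at t = f x.  As x runs over the manifold, f x runs over the whole image
    of f, and the two families of equations coincide.

    The gradient is defined by a choice operator, so this needs the existence of
    a vector representing df ([gradientP]), which rests on the finite-dimensional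
    Riesz representation for nondegenerate symmetric forms
    ([nondegenerate_riesz]). *)

Lemma nondegenerate_inj {F : fieldType} {V : vectType F} {b : {symmetric V}}
    {v v' : V} :
  nondegenerate b -> (forall X, b v X = b v' X) -> v = v'.
Proof.
move=> /eqP b_nd bvv'; apply/eqP; rewrite -subr_eq0 -memv0 -b_nd.
by apply/mem_orthovP => X _; rewrite linearBl /= bvv' subrr.
Qed.

(** The flat map v |-> b v is injective by [nondegenerate_inj], and a space and
    its dual have the same finite dimension, so the flat map is onto. *)
Lemma nondegenerate_riesz {F : fieldType} {V : vectType F} {b : {symmetric V}}
    (phi : {linear V -> F^o}) :
  nondegenerate b -> exists v, forall X, b v X = phi X.
Proof.
move=> b_nd.
(* [applyr b v] is linear for the plain scaling of F^o, whereas [b v] is linear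
   only for the scaling twisted by the identity morphism; symmetry of b makes
   the two functions agree. *)
pose flat (v : V) : 'Hom(V, F^o) := linfun (applyr b v : V -> F^o).
have flatE v X : flat v X = b v X by rewrite lfunE /= hermC expr0 mul1r.
have flat_lin : linear flat.
  by move=> k v v'; apply/lfunP => X; rewrite flatE linearPl add_lfunE scale_lfunE !flatE.
pose flatL := GRing.isLinear.Build _ _ _ _ flat flat_lin.
pose J : 'Hom(V, 'Hom(V, F^o)) :=
  linfun (HB.pack_for {linear V -> 'Hom(V, F^o)} flat flatL).
have JE v : J v = flat v by rewrite lfunE.
have kerJ : lker J == 0%VS.
  apply/lker0P => v v'; rewrite !JE => flatvv'.
  by apply: (nondegenerate_inj b_nd) => X; rewrite -!flatE flatvv'.
have imJ : limg J = fullv.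
  apply/eqP; rewrite eqEdim subvf /= limg_dim_eq; last first.
    by rewrite (eqP kerJ) capv0.
  by rewrite !dimvf /dim /= muln1.
have /memv_imgP[v _ phiE] : linfun phi \in limg J by rewrite imJ memvf.
by exists v => X; rewrite -flatE -JE -phiE lfunE.
Qed.

(** The set from which the gradient is chosen is nonempty, because the
    differential is linear and hence represented by a vector; so the default
    value 0 of the choice is never used. *)
Lemma gradientP (R : realType) (n : nat) (M : smoothManifold R n)
    (g : semiRiemannianMetric M) (f : M -> R) (p : M) (X : tangent p) :
  g p (gradient g f p) X = differential f X.
Proof.
move: X; apply: (@xgetPex _ 0 [set v : tangent p |
  forall X : tangent p, g p v X = differential f X]).
exact: (@nondegenerate_riesz R (tangent p) (g p)
  ('d (f \o chart_inv (chart_at p)) (chart_at p p))) (metric_nondegenerate g p).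
Qed.

(** Chain rule, read in the preferred chart at p: (w o f) o c^-1 is w composed
    with the coordinate expression f o c^-1, whose value at c p is f p. *)
Lemma differential_comp (R : realType) (n : nat) (M : smoothManifold R n)
    (f : M -> R) (w : R -> R) (p : M) (X : tangent p) :
  smooth_fun f -> differentiable w (f p) ->
  differential (w \o f) X = derive1 w (f p) * differential f X.
Proof.
move=> f_smooth w_diff; rewrite /differential.
set c := chart_at p.
have cp : chart_inv c (c p) = p by apply: chart_mapK; exact: chart_at_dom.
have f_diff : differentiable (f \o chart_inv c) (c p).
  have [+ _] := f_smooth c (chart_at_atlas p) 1%N.
  by apply; apply: chart_map_cod; exact: chart_at_dom.
rewrite -compA diff_comp //=; last by rewrite cp.
by rewrite cp diff1E // mulrC.
Qed.

Lemma gradient_comp (R : realType) (n : nat) (M : smoothManifold R n)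
    (g : semiRiemannianMetric M) (f : M -> R) (w : R -> R) (p : M) :
  smooth_fun f -> differentiable w (f p) ->
  gradient g (w \o f) p = derive1 w (f p) *: gradient g f p.
Proof.
move=> f_smooth w_diff.
apply: (nondegenerate_inj (metric_nondegenerate g p)) => X.
by rewrite gradientP differential_comp // linearZl_LR /= gradientP.
Qed.

Theorem proposition1 (R : realType) (n : nat) (hn : (3 <= n)%N)
    (M : smoothManifold R n) (g : semiRiemannianMetric M)
    (f : M -> R) (a : R -> R) (hf : transnormal_with g f a)
    (w : R -> R) (hw : smooth_on setT w)
    (F : M -> R -> R -> R) (hF : invariant_fst f F)
    (Fhat : range f -> R -> R -> R)
    (hFhat : forall (x : M) (r p : R), F x r p = Fhat (to_image f x) r p) :
  let u : M -> R := w \o f in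
  (forall x : M, F x (u x) (g x (gradient g u x) (gradient g u x)) = 0) <->
  (forall t : range f,
      Fhat t (w (val t)) (a (val t) * `|derive1 w (val t)| ^+ 2) = 0).
Proof.
move=> u; have [f_smooth _ grad_f] := hf.
have grad_u x : g x (gradient g u x) (gradient g u x) =
    a (f x) * `|derive1 w (f x)| ^+ 2.
  have w_diff : differentiable w (f x) by have [+ _] := hw 1%N; apply.
  rewrite gradient_comp // linearZl_LR linearZr_LR /= grad_f.
  by rewrite real_normK ?num_real // expr2 mulrA mulrC.
have FE x : F x (u x) (g x (gradient g u x) (gradient g u x)) =
    Fhat (to_image f x) (w (f x)) (a (f x) * `|derive1 w (f x)| ^+ 2).
  by rewrite hFhat grad_u.
split=> [u_sol t|w_sol x]; last by rewrite FE; exact: (w_sol (to_image f x)).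
have [x _ fx] : range f (val t) by exact/set_mem/(valP t).
have -> : t = to_image f x by exact/val_inj/esym.
by rewrite -FE.
Qed.
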